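(* Let $(V,E)$ be a multigraph with no isolated vertex and let $\beta:L^2(E)\to L^2(E)\otimes\mathcal{A}$ be a bi-unitary co-representation of a compact quantum group $(\mathcal{A},\Delta)$. Let $Ad_\beta$ be the co-action on $B(L^2(E))$ implemented by the unitary co-representation $\beta$. Then the following conditions are equivalent: (1) $Ad_\beta(S(C(V^s)))\subseteq S(C(V^s))\otimes\mathcal{A}$. (2) There exists a co-action $\alpha_s:C(V^s)\to C(V^s)\otimes\mathcal{A}$ of $(\mathcal{A},\Delta)$ such that $\alpha_s(\chi_i)\beta(\chi_\tau)=\beta(\chi_i.\chi_\tau)$ for all $i\in V^s$ and $\tau\in E$.
   Context: A multigraph $(V,E)$ consists of finite sets $V$ (vertices), $E$ (edges) and source and target maps $s,t:E\to V$. No isolated vertex: every vertex is the source or target of some edge. $E^v=\{\tau\in E:s(\tau)=v\}$ and $V^s=s(E)$. For a finite set $X$, $C(X)$ is the algebra of complex functions on $X$ with basis the characteristic functions $\chi_x$, and $L^2(X)$ is the same space as a Hilbert space with orthonormal basis $(\chi_x)$. $C(V^s)$ acts on the left of $L^2(E)$ by $\chi_i.\chi_\tau=\delta_{i,s(\tau)}\chi_\tau$, extended by $(f\otimes a)(\xi\otimes b)=f.\xi\otimes ab$ for $a,b\in\mathcal{A}$. $p_\tau\in B(L^2(E))$ is the projection onto $\mathbb{C}\chi_\tau$, and $S:C(V^s)\to B(L^2(E))$ is the injective algebra map $S(\chi_v)=\sum_{\tau\in E^v}p_\tau$. Compact quantum groups are in Woronowicz's sense; C*-algebras are unital, tensor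 products minimal. A co-representation of $(\mathcal{A},\Delta)$ on $L^2(E)$ is a linear map $\beta$ with $\beta(\chi_\tau)=\sum_\sigma\chi_\sigma\otimes u^\sigma_\tau$ and $\Delta(u^\sigma_\tau)=\sum_\kappa u^\sigma_\kappa\otimes u^\kappa_\tau$; $U=(u^\sigma_\tau)$ is its co-representation matrix. It is unitary if $U$ is unitary; the contragradient $\overline\beta$ has matrix $(u^{\sigma*}_\tau)$; $\beta$ is bi-unitary if both $\beta$ and $\overline\beta$ are unitary. For unitary $\beta$, $Ad_\beta(T)=U(T\otimes1)U^*$ for $T\in B(L^2(E))$, with $U$ viewed in $B(L^2(E))\otimes\mathcal{A}$. A co-action of $(\mathcal{A},\Delta)$ on a unital C*-algebra $\mathcal{B}$ is a unital $*$-homomorphism $\alpha:\mathcal{B}\to\mathcal{B}\otimes\mathcal{A}$ with $(\alpha\otimes id)\alpha=(id\otimes\Delta)\alpha$ and $\mathrm{span}\,\alpha(\mathcal{B})(1\otimes\mathcal{A})$ norm-dense in $\mathcal{B}\otimes\mathcal{A}$. *)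

(* Defs.v *)
From HB Require Import structures.
From mathcomp Require Import all_boot all_order all_algebra.
From mathcomp Require Import complex.
From mathcomp Require Import all_classical all_reals.
Set Implicit Arguments.
Unset Strict Implicit.
Unset Printing Implicit Defensive.
Import Order.TTheory GRing.Theory Num.Theory.
Local Open Scope classical_set_scope.
Local Open Scope ring_scope.

(** * Unital C*-algebras *)

(* The norm is a field of the mixin because mathcomp-analysis has no structure
   of normed algebra, and no join of normed modules and rings can be declared
   after that of numeric domains.  An [algType] is nonzero: [1 != 0]. *)
HB.mixin Record Algebra_isCStar (R : realType) A of GRing.Algebra R[i] A := {
  star : A -> A ;
  cnorm : A -> R ;
  starD : forall x y : A, star (x + y) = star x + star y ;
  starZ : forall (c : R[i]) (x : A), star (c *: x) = c^* *: star x ;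
  starM : forall x y : A, star (x * y) = star y * star x ;
  starK : involutive star ;
  cnorm_eq0 : forall x : A, cnorm x = 0 -> x = 0 ;
  cnormD : forall x y : A, cnorm (x + y) <= cnorm x + cnorm y ;
  cnormZ : forall (c : R[i]) (x : A),
    (cnorm (c *: x))%:C%C = `|c| * (cnorm x)%:C%C ;
  cnormM : forall x y : A, cnorm (x * y) <= cnorm x * cnorm y ;
  cnorm_star : forall x : A, cnorm (star x * x) = cnorm x ^+ 2 ;
  cnorm_complete : forall u : nat -> A,
    (forall e, 0 < e -> exists N, forall m n, (N <= m)%N -> (N <= n)%N ->
       cnorm (u m - u n) < e) ->
    exists l, forall e, 0 < e -> exists N, forall n, (N <= n)%N ->
       cnorm (u n - l) < e
}.

#[short(type="cstarAlgType")]
HB.structure Definition CStarAlgebra (R : realType) :=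
  {A of GRing.Algebra R[i] A & Algebra_isCStar R A}.

Definition norm_dense (R : realType) (A : cstarAlgType R) (D : set A) : Prop :=
  forall (x : A) (e : R), 0 < e -> exists2 y, D y & cnorm (x - y) < e.

Record unital_star_hom (R : realType) (A B : cstarAlgType R) (f : A -> B) :
    Prop := {
  ush_add : forall x y, f (x + y) = f x + f y ;
  ush_scale : forall (c : R[i]) x, f (c *: x) = c *: f x ;
  ush_mul : forall x y, f (x * y) = f x * f y ;
  ush_one : f 1 = 1 ;
  ush_star : forall x, f (star x) = star (f x)
}.

Definition lin_span (K : pzRingType) (M : lmodType K) (D : set M) : set M :=
  [set x | exists n (c : 'I_n -> K) (d : 'I_n -> M),
     (forall i, D (d i)) /\ x = \sum_(i < n) c i *: d i].

(** * Minimal tensor products *)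

Definition lin_indep (K : pzRingType) (M : lmodType K) n (a : 'I_n -> M) :=
  forall c : 'I_n -> K, \sum_(i < n) c i *: a i = 0 -> forall i, c i = 0.

(* [T] is the completion of the algebraic tensor product of [A] and [B] for
   some C*-norm, with [t a b] the elementary tensor of [a] and [b].  By
   bilinearity, [cst_inj] says that the linear map from the algebraic tensor
   product to [T] is injective. *)
Record cstar_tensor (R : realType) (A B T : cstarAlgType R) (t : A -> B -> T) :
    Prop := {
  cst_addl : forall a a' b, t (a + a') b = t a b + t a' b ;
  cst_addr : forall a b b', t a (b + b') = t a b + t a b' ;
  cst_scalel : forall (c : R[i]) a b, t (c *: a) b = c *: t a b ;
  cst_scaler : forall (c : R[i]) a b, t a (c *: b) = c *: t a b ;
  cst_mul : forall a a' b b', t a b * t a' b' = t (a * a') (b * b') ;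
  cst_one : t 1 1 = 1 ;
  cst_star : forall a b, star (t a b) = t (star a) (star b) ;
  cst_inj : forall n (a : 'I_n -> A) (b : 'I_n -> B), lin_indep a ->
    \sum_(i < n) t (a i) (b i) = 0 -> forall i, b i = 0 ;
  cst_dense : norm_dense (lin_span [set x | exists a b, x = t a b])
}.

(* The minimal tensor product: its norm is the least C*-norm on the algebraic
   tensor product.  This determines [(T, t)] up to a unique isomorphism. *)
Definition min_tensor (R : realType) (A B T : cstarAlgType R)
    (t : A -> B -> T) : Prop :=
  cstar_tensor t /\
  forall (T' : cstarAlgType R) (t' : A -> B -> T'), cstar_tensor t' ->
  forall n (a : 'I_n -> A) (b : 'I_n -> B),
    cnorm (\sum_(i < n) t (a i) (b i)) <= cnorm (\sum_(i < n) t' (a i) (b i)).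

(** * Compact quantum groups *)

(* [cqg_AA] and [cqg_AAA] are (arbitrary models of) the minimal tensor products
   [A (x) A] and [A (x) A (x) A]; the latter is at once [(A (x) A) (x) A] via
   [cqg_tl] and [A (x) (A (x) A)] via [cqg_tr].  In [cqg_coassoc], [L] and [M]
   are [Delta (x) id] and [id (x) Delta]: a unital *-homomorphism, being
   continuous, is determined by its values on elementary tensors. *)
Record compactQuantumGroup (R : realType) := CompactQuantumGroup {
  cqg_alg :> cstarAlgType R ;
  cqg_AA : cstarAlgType R ;
  cqg_t : cqg_alg -> cqg_alg -> cqg_AA ;
  cqg_tP : min_tensor cqg_t ;
  cqg_AAA : cstarAlgType R ;
  cqg_tl : cqg_AA -> cqg_alg -> cqg_AAA ;
  cqg_tlP : min_tensor cqg_tl ;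
  cqg_tr : cqg_alg -> cqg_AA -> cqg_AAA ;
  cqg_trP : min_tensor cqg_tr ;
  cqg_tA : forall a b c, cqg_tl (cqg_t a b) c = cqg_tr a (cqg_t b c) ;
  cqg_Delta : cqg_alg -> cqg_AA ;
  cqg_Delta_hom : unital_star_hom cqg_Delta ;
  cqg_coassoc : exists L M : cqg_AA -> cqg_AAA,
    [/\ unital_star_hom L /\ unital_star_hom M,
        forall a b, L (cqg_t a b) = cqg_tl (cqg_Delta a) b,
        forall a b, M (cqg_t a b) = cqg_tr a (cqg_Delta b)
      & forall a, L (cqg_Delta a) = M (cqg_Delta a)] ;
  cqg_densel :
    norm_dense (lin_span [set x | exists a b, x = cqg_t b 1 * cqg_Delta a]) ;
  cqg_denser :
    norm_dense (lin_span [set x | exists a b, x = cqg_t 1 b * cqg_Delta a])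
}.

(** * Functions on finite sets *)

(* For a finite set [X], [C(X)] and [L^2(X)] are [{ffun X -> R[i]}], and
   [C(X) (x) A], [L^2(X) (x) A] are [{ffun X -> A}]: the function [F] stands for
   the sum over [x] of [chi x (x) F x].  Operations in [C(X) (x) A] are
   pointwise and its C*-norm is the sup norm. *)
Definition chi (R : realType) (X : finType) (x : X) : {ffun X -> R[i]} :=
  [ffun y => (y == x)%:R].

(* In [coact_coassoc] both sides are in [C(X) (x) A (x) A]; the left one is
   [(alpha (x) id) (alpha f)], computed from the expansion of [alpha f] as the
   sum over [x] of [chi x (x) alpha f x]. *)
Record coaction (R : realType) (A : compactQuantumGroup R) (X : finType)
    (alpha : {linear {ffun X -> R[i]} -> {ffun X -> A}}) : Prop := {
  coact_mul : forall f g, alpha (f * g) = alpha f * alpha g ;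
  coact_one : alpha 1 = 1 ;
  coact_star : forall f : {ffun X -> R[i]},
    alpha [ffun x => (f x)^*] = [ffun x => star (alpha f x)] ;
  coact_coassoc : forall (f : {ffun X -> R[i]}) (y : X),
    \sum_(x : X) cqg_t (alpha (chi R x) y) (alpha f x)
      = cqg_Delta (alpha f y) ;
  coact_dense : forall (F : {ffun X -> A}) (e : R), 0 < e ->
    exists2 G : {ffun X -> A},
      lin_span [set H : {ffun X -> A} |
                 exists f a, H = [ffun x => alpha f x * a]] G
      & forall x, cnorm (F x - G x) < e
}.

(** * Co-representations on [L^2(E)] *)

(* [u^sigma_tau] is the coefficient of [chi sigma] in [beta (chi tau)]. *)
Definition coef (R : realType) (A : compactQuantumGroup R) (E : finType)
    (beta : {linear {ffun E -> R[i]} -> {ffun E -> A}}) (sigma tau : E) : A :=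
  beta (chi R tau) sigma.

Definition corepresentation (R : realType) (A : compactQuantumGroup R)
    (E : finType) (beta : {linear {ffun E -> R[i]} -> {ffun E -> A}}) : Prop :=
  forall sigma tau : E,
    cqg_Delta (coef beta sigma tau) =
    \sum_(kappa : E) cqg_t (coef beta sigma kappa) (coef beta kappa tau).

(* [B(L^2(E))] is ['M[R[i]]_#|E|] and [B(L^2(E)) (x) A] is ['M[A]_#|E|], rows
   and columns being indexed by the enumeration of [E]. *)
Definition corep_mx (R : realType) (A : compactQuantumGroup R) (E : finType)
    (beta : {linear {ffun E -> R[i]} -> {ffun E -> A}}) : 'M[A]_#|E| :=
  \matrix_(i, j) coef beta (enum_val i) (enum_val j).

Definition contragredient_mx (R : realType) (A : compactQuantumGroup R)
    (E : finType) (beta : {linear {ffun E -> R[i]} -> {ffun E -> A}}) :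
    'M[A]_#|E| :=
  map_mx star (corep_mx beta).

Definition adj_mx (R : realType) (A : cstarAlgType R) n (M : 'M[A]_n) :
    'M[A]_n :=
  (map_mx star M)^T.

Definition unitary_mx (R : realType) (A : cstarAlgType R) n (M : 'M[A]_n) :
    Prop :=
  adj_mx M *m M = 1%:M /\ M *m adj_mx M = 1%:M.

Definition bi_unitary (R : realType) (A : compactQuantumGroup R)
    (E : finType) (beta : {linear {ffun E -> R[i]} -> {ffun E -> A}}) : Prop :=
  unitary_mx (corep_mx beta) /\ unitary_mx (contragredient_mx beta).

Definition tens_mx (R : realType) (A : cstarAlgType R) n (T : 'M[R[i]]_n)
    (a : A) : 'M[A]_n :=
  map_mx (fun c => c *: a) T.

Definition Ad (R : realType) (A : compactQuantumGroup R) (E : finType)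
    (beta : {linear {ffun E -> R[i]} -> {ffun E -> A}})
    (T : 'M[R[i]]_#|E|) : 'M[A]_#|E| :=
  corep_mx beta *m tens_mx T 1 *m adj_mx (corep_mx beta).

(* [D (x) A] inside [B(L^2(E)) (x) A], for a subspace [D] of the
   finite-dimensional space [B(L^2(E))]: no closure is needed. *)
Definition sub_tens (R : realType) (A : cstarAlgType R) n
    (D : set 'M[R[i]]_n) : set 'M[A]_n :=
  [set M | exists m (T : 'I_m -> 'M[R[i]]_n) (a : 'I_m -> A),
     (forall k, D (T k)) /\ M = \sum_(k < m) tens_mx (T k) (a k)].

Arguments sub_tens {R} A {n} D _.

(** * Multigraphs *)

Record multigraph := Multigraph {
  vert : finType ;
  edge : finType ;
  src : edge -> vert ;
  tgt : edge -> vert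
}.

Definition no_isolated_vertex (G : multigraph) : Prop :=
  forall v : vert G, exists tau : edge G, src tau = v \/ tgt tau = v.

Definition src_set (G : multigraph) : {set vert G} :=
  [set src tau | tau : edge G].

Definition Vs (G : multigraph) : finType := {v : vert G | v \in src_set G}.

Definition src_s (G : multigraph) (tau : edge G) : Vs G :=
  exist _ (src tau) (imset_f (@src G) (isT : tau \in edge G)).

(* With [K := R[i]] this is the left action of [C(V^s)] on [L^2(E)], with
   [K := A] that of [C(V^s) (x) A] on [L^2(E) (x) A]; see [act_chi] and
   [act_tens]. *)
Definition act (G : multigraph) (K : pzRingType) (F : {ffun Vs G -> K})
    (xi : {ffun edge G -> K}) : {ffun edge G -> K} :=
  [ffun tau => F (src_s tau) * xi tau].

Lemma act_chi (R : realType) (G : multigraph) (i : Vs G) (tau : edge G) :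
  act (chi R i) (chi R tau) = (i == src_s tau)%:R *: chi R tau.
Proof.
apply/ffunP=> sigma; rewrite !ffunE.
case: (eqVneq sigma tau) => [->|_]; last by rewrite mulr0 scaler0.
by rewrite eq_sym mulr1 /GRing.scale /= mulr1.
Qed.

Lemma act_tens (R : realType) (A : cstarAlgType R) (G : multigraph)
    (f : {ffun Vs G -> R[i]}) (a : A) (xi : {ffun edge G -> R[i]}) (b : A) :
  act [ffun v => f v *: a] [ffun tau => xi tau *: b]
    = [ffun tau => act f xi tau *: (a * b)].
Proof. by apply/ffunP=> tau; rewrite !ffunE -scalerAl -scalerAr scalerA. Qed.

Definition proj_edge (R : realType) (G : multigraph) (tau : edge G) :
    'M[R[i]]_#|edge G| :=
  delta_mx (enum_rank tau) (enum_rank tau).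

Definition Smap (R : realType) (G : multigraph) (f : {ffun Vs G -> R[i]}) :
    'M[R[i]]_#|edge G| :=
  \sum_(v : Vs G) f v *: \sum_(tau | src_s tau == v) proj_edge R tau.

(* Main.v *)
From HB Require Import structures.
Require Import Defs.
From mathcomp Require Import all_boot all_order all_algebra.
From mathcomp Require Import complex.
From mathcomp Require Import all_classical all_reals.
From mathcomp Require Import lra zify.
Import Order.TTheory GRing.Theory Num.Theory.
Local Open Scope classical_set_scope.
Local Open Scope ring_scope.

(** Write [u sigma tau] for the matrix coefficients of [beta], [s] for the
    source map and [E^i] for the set of edges with source [i].  The entry of
    [Ad_beta (S (chi i))] at [(sigma, rho)] is the sum of
    [u sigma tau * star (u rho tau)] over [tau] in [E^i].  Condition (1) says
    that this matrix is diagonal, with an entry [q i v] at [(sigma, sigma)]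
    that depends only on [v = s sigma] (lemma [sub_tens_SmapP]).

    From (2) to (1): the module condition reads
    [alpha (chi i) (s sigma) * u sigma tau = u sigma tau] if [s tau = i], and
    [0] otherwise; multiplying by [star (u rho tau)] and summing over [tau],
    the row relations of [U] make the matrix diagonal with entries
    [alpha (chi i) (s sigma)].

    From (1) to (2): put [alpha (chi i) v = q i v].  The relations between the
    coefficients of [U] show that the [q i v] are projections with
    [q i v * q j v = 0] for [i != j] and [\sum_i q i v = 1], that the module
    condition holds, and that [alpha] is coassociative.  The density condition
    is the hard point.  Coassociative unital *-homomorphisms need not satisfy
    it: for [A] the complex numbers, composition with a non-injective
    idempotent map of [V^s] does not.  Here bi-unitarity helps: since the
    contragredient is unitary too, [\sum_v n v * q i v = n i], where [n v] is
    the number of edges in [E^v].  These weighted column sums force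
    [q i v * q i w = 0] for [v != w] (lemma [weighted_magic_orthogonal]), so
    that [F] in [C(V^s) (x) A] is exactly
    [\sum_i alpha (chi i) (1 (x) \sum_w q i w * F w)].

    That lemma needs one positivity fact: if nonnegative multiples of
    compressions [p * r * p] of projections add up to [0], each of them
    vanishes.  Instead of the theory of positive elements, the proof uses that
    a projection [p] is an extreme point of the unit ball of [p A p]
    ([proj_extreme]), which holds in every Banach algebra. *)

(** * The star operation and the norm of a C*-algebra *)

Lemma star0 {R : realType} {A : cstarAlgType R} : star (0 : A) = 0.
Proof. by rewrite -(scale0r (0 : A)) starZ conjC0 !scale0r. Qed.

Lemma star1 {R : realType} {A : cstarAlgType R} : star (1 : A) = 1.
Proof. by rewrite -[LHS]mulr1 -{2}(starK (1 : A)) -starM mulr1 starK. Qed.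

Lemma starN {R : realType} {A : cstarAlgType R} (x : A) : star (- x) = - star x.
Proof. by rewrite -scaleN1r starZ rmorphN rmorph1 scaleN1r. Qed.

Lemma star_sum {R : realType} {A : cstarAlgType R} (I : Type) (r : seq I)
    (P : pred I) (F : I -> A) :
  star (\sum_(i <- r | P i) F i) = \sum_(i <- r | P i) star (F i).
Proof. exact: (big_morph _ (@starD R A) star0). Qed.

Lemma cnormZr {R : realType} {A : cstarAlgType R} (r : R) (x : A) :
  cnorm (r%:C%C *: x) = `|r| * cnorm x.
Proof.
apply: complexI; rewrite cnormZ rmorphM; congr (_ * _).
by rewrite normc_def /= expr0n addr0 sqrtr_sqr.
Qed.

Lemma cnorm0 {R : realType} {A : cstarAlgType R} : cnorm (0 : A) = 0.
Proof. by rewrite -(scale0r (0 : A)) cnormZr normr0 mul0r. Qed.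

Lemma cnormN {R : realType} {A : cstarAlgType R} (x : A) :
  cnorm (- x) = cnorm x.
Proof.
by rewrite -scaleN1r (_ : -1 = (-1)%:C%C) ?cnormZr ?normrN1 ?mul1r ?rmorphN1.
Qed.

Lemma cnorm_ge0 {R : realType} {A : cstarAlgType R} (x : A) : 0 <= cnorm x.
Proof.
have := cnormD x (- x); rewrite subrr cnorm0 cnormN; lra.
Qed.

Lemma cnormMn {R : realType} {A : cstarAlgType R} (x : A) n :
  cnorm (x *+ n) = n%:R * cnorm x.
Proof.
by rewrite -scaler_nat -(rmorph_nat (@real_complex R)) cnormZr normr_nat.
Qed.

Lemma cnorm_sum {R : realType} {A : cstarAlgType R} (I : Type) (r : seq I)
    (P : pred I) (F : I -> A) :
  cnorm (\sum_(i <- r | P i) F i) <= \sum_(i <- r | P i) cnorm (F i).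
Proof.
elim/big_rec2: _ => [|i y x _ le_xy]; first by rewrite cnorm0.
by apply: le_trans (cnormD _ _) _; rewrite lerD2l.
Qed.

Definition is_proj {R : realType} {A : cstarAlgType R} (p : A) : Prop :=
  star p = p /\ p * p = p.

Lemma is_proj1 {R : realType} {A : cstarAlgType R} : is_proj (1 : A).
Proof. by split; rewrite ?star1 ?mulr1. Qed.

(** By the C*-identity, the norm of a projection is equal to its square. *)
Lemma cnorm_proj_le1 {R : realType} {A : cstarAlgType R} (p : A) :
  is_proj p -> cnorm p <= 1.
Proof.
move=> [ps pp]; have := cnorm_star p; rewrite ps pp => e.
have := cnorm_ge0 p; nra.
Qed.

Lemma cnorm1_le1 {R : realType} {A : cstarAlgType R} : cnorm (1 : A) <= 1.
Proof. exact: (cnorm_proj_le1 _ is_proj1). Qed.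

(** [1 - 2 r] is a self-adjoint unitary. *)
Lemma cnorm_reflection_le1 {R : realType} {A : cstarAlgType R} (r : A) :
  is_proj r -> cnorm (1 - r *+ 2) <= 1.
Proof.
move=> [rs rr]; have := cnorm_star (1 - r *+ 2).
have -> : star (1 - r *+ 2) * (1 - r *+ 2) = 1.
  rewrite starD starN (mulr2n r) starD rs -(mulr2n r) star1 mulrBl mul1r.
  by rewrite mulrBr mulr1 mulrnAl mulrnAr rr (mulr2n (_ *+ 2)) opprB addrK subrK.
have := @cnorm1_le1 R A; have := cnorm_ge0 (1 - r *+ 2); nra.
Qed.

Lemma cnormM_le1 {R : realType} {A : cstarAlgType R} (x y : A) :
  cnorm x <= 1 -> cnorm y <= 1 -> cnorm (x * y) <= 1.
Proof.
move=> x1 y1; apply: le_trans (cnormM _ _) _.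
by rewrite mulr_ile1 ?cnorm_ge0.
Qed.

Lemma cnormX_le1 {R : realType} {A : cstarAlgType R} (x : A) n :
  cnorm x <= 1 -> cnorm (x ^+ n) <= 1.
Proof.
move=> x1; elim: n => [|n IHn]; first exact: cnorm1_le1.
by rewrite exprS cnormM_le1.
Qed.

(** * Extreme points of the unit ball *)

Lemma leq_bin_half m j : (j < m)%N -> ('C(m.*2, j) <= 'C(m.*2, j.+1))%N.
Proof.
move=> ltjm; rewrite -(leq_pmul2l (ltn0Sn j)) mul_bin_left leq_mul2r.
by apply/orP; right; lia.
Qed.

Lemma geq_bin_half m j : (m <= j)%N -> ('C(m.*2, j.+1) <= 'C(m.*2, j))%N.
Proof.
move=> lemj; rewrite -(leq_pmul2l (ltn0Sn j)) mul_bin_left leq_mul2r.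
by apply/orP; right; lia.
Qed.

(** This makes the central binomial coefficient negligible against [4 ^ m],
    the only asymptotic fact behind [proj_extreme]. *)
Lemma central_bin_sqr_le m :
  ('C(m.*2, m) ^ 2 * m.*2.+1 <= 2 ^ m.*2 * 2 ^ m.*2)%N.
Proof.
elim: m => // m IHm.
have e : (m.+1 * 'C(m.+1.*2, m.+1) = 2 * (m.*2.+1 * 'C(m.*2, m)))%N.
  have e1 := mul_bin_diag m.+1.*2 m; rewrite /= in e1.
  have e2 := mul_bin_diag m.*2.+1 m.
  have e3 := mul_bin_left m.*2.+1 m.
  have e4 : 'C(m.*2.+1, m) = 'C(m.*2.+1, m.+1).
    rewrite -[in RHS]bin_sub; last by lia.
    by congr 'C(_, _); lia.
  rewrite /= -e4 in e2; rewrite doubleS in e1 *; nia.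
rewrite -(leq_pmul2l (_ : 0 < m.+1 ^ 2)%N) ?expn_gt0 // mulnA -expnMn e.
rewrite doubleS !expnS expn0 !muln1.
set c := 'C(_, _) in IHm *; set P := (2 ^ _)%N in IHm *.
rewrite !expnS expn0 muln1 in IHm.
have : (m.*2.+1 * m.*2.+3 <= m.+1 * m.+1 * 4)%N by lia.
nia.
Qed.

(** Expanded on the monomials of degree [2 m + 1] in [x] and [y], the product
    has as coefficients the differences of consecutive binomial coefficients.
    These rise up to [m] and then fall, so the absolute values of the
    differences add up to [2 * 'C(2 m, m)], much less than the trivial bound
    [2 * 4 ^ m]. *)
Lemma cnorm_commuting_contractions {R : realType} {A : cstarAlgType R}
    (x y : A) m :
  GRing.comm x y -> cnorm x <= 1 -> cnorm y <= 1 ->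
  cnorm ((x - y) * (x + y) ^+ m.*2) <= 2 * 'C(m.*2, m)%:R.
Proof.
move=> xy x1 y1; set n := m.*2.
pose c k := 'C(n, k); pose G k := x ^+ (n.+1 - k) * y ^+ k.
have G1 k : cnorm (G k) <= 1 by rewrite cnormM_le1 ?cnormX_le1.
(* Summation by parts; [W] adds up the differences of coefficients. *)
pose W j := \sum_(i < j) (G i - G i.+1) *+ c i + G j *+ c j.
have -> : (x - y) * (x + y) ^+ n = W n.+1.
  rewrite /W /c bin_small // mulr0n addr0 exprDn_comm // mulr_sumr.
  apply: eq_bigr => -[i /= ltin] _; rewrite mulrnAr; congr (_ *+ _).
  rewrite mulrBl /G subSS mulrA -exprS subSn // mulrA.
  by rewrite (commrX _ (commr_sym xy)) -mulrA -exprS.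
have WS j : W j.+1 = W j + (G j.+1 *+ c j.+1 - G j.+1 *+ c j).
  rewrite /W big_ord_recr /= mulrnBl -!addrA; congr (_ + (_ + _)).
  by rewrite addrC.
have Wup j : (j <= m)%N -> cnorm (W j) <= (c j)%:R.
  elim: j => [|j IHj] lejm.
    by rewrite /W big_ord0 add0r /c bin0 mulr1n G1.
  rewrite WS; apply: le_trans (cnormD _ _) _.
  have lec : (c j <= c j.+1)%N by exact: leq_bin_half.
  rewrite -mulrnBr // cnormMn natrB //.
  have := IHj (ltnW lejm); have := G1 j.+1; have := cnorm_ge0 (G j.+1).
  have : (c j)%:R <= (c j.+1)%:R :> R by rewrite ler_nat.
  nra.
have Wdown j : cnorm (W (m + j)%N) <= 2 * (c m)%:R - (c (m + j)%N)%:R.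
  elim: j => [|j IHj].
    by rewrite addn0; have := Wup m (leqnn m); lra.
  rewrite addnS WS; apply: le_trans (cnormD _ _) _.
  have lec : (c (m + j).+1 <= c (m + j))%N by apply: geq_bin_half; lia.
  rewrite -opprB cnormN -mulrnBr // cnormMn natrB //.
  have := G1 (m + j).+1; have := cnorm_ge0 (G (m + j).+1).
  have : (c (m + j).+1)%:R <= (c (m + j))%:R :> R by rewrite ler_nat.
  move: IHj; nra.
have -> : n.+1 = (m + m.+1)%N by rewrite /n; lia.
by apply: le_trans (Wdown _) _; rewrite gerDl oppr_le0 ler0n.
Qed.

(** [p] is an extreme point of the unit ball of [p A p].  With [x = p + z] and
    [y = p - z], the product bounded in [cnorm_commuting_contractions] is
    [2 ^ (2 m + 1)] times [z], so that [cnorm z] is at most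
    ['C(2 m, m) / 4 ^ m] for every [m]. *)
Lemma proj_extreme {R : realType} {A : cstarAlgType R} (p z : A) :
  p * p = p -> p * z = z -> z * p = z ->
  cnorm (p + z) <= 1 -> cnorm (p - z) <= 1 -> z = 0.
Proof.
move=> pp pz zp zD zB; apply: cnorm_eq0.
have comm_pz : GRing.comm (p + z) (p - z).
  rewrite /GRing.comm !mulrDl !mulrDr !mulNr !mulrN pp pz zp.
  by rewrite !addrA addrK subrK.
have bound m : cnorm z * 2 ^+ m.*2 <= 'C(m.*2, m)%:R.
  have := cnorm_commuting_contractions _ _ m comm_pz zD zB.
  have -> : p + z - (p - z) = z *+ 2.
    by rewrite opprB [p + z]addrC addrACA subrr addr0 mulr2n.
  have -> : p + z + (p - z) = p *+ 2 by rewrite addrACA subrr addr0 mulr2n.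
  have -> : z *+ 2 * (p *+ 2) ^+ m.*2 = z *+ 2 *+ 2 ^ m.*2.
    rewrite exprMn_n mulrnAl !mulrnAr mulrnAC; do 2 congr (_ *+ _).
    by elim: {1}m.*2 => [|k IHk]; rewrite ?mulr1 // exprS mulrA zp.
  by rewrite !cnormMn natrX; lra.
have bound_sqr m : cnorm z ^+ 2 * m.*2.+1%:R <= 1.
  have cb := central_bin_sqr_le m.
  rewrite -(ler_nat R) !natrM !natrX in cb.
  have Pgt0 : 0 < 2 ^+ m.*2 :> R by rewrite exprn_gt0.
  have bm := bound m; have z0 := cnorm_ge0 z.
  set P := 2 ^+ _ in cb Pgt0 bm; set C := 'C(_, _)%:R in cb bm.
  have sq : (cnorm z * P) ^+ 2 <= C ^+ 2.
    by rewrite lerXn2r ?nnegrE ?ler0n ?mulr_ge0 // ltW.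
  rewrite -(ler_pM2r (_ : 0 < P ^+ 2)) ?exprn_gt0 // mul1r.
  apply: le_trans (_ : C ^+ 2 * m.*2.+1%:R <= _); last by rewrite expr2.
  by rewrite mulrAC -exprMn ler_wpM2r ?ler0n.
apply/eqP; rewrite -sqrf_eq0 eq_le sqr_ge0 andbT leNgt; apply/negP => z2.
have := archi_boundP (ltW (_ : 0 < (cnorm z ^+ 2)^-1)); rewrite invr_gt0.
move=> /(_ z2); set b := Num.bound _ => ltb.
have : 1 < cnorm z ^+ 2 * b.*2.+1%:R.
  rewrite -ltr_pdivrMl // mulr1; apply: lt_le_trans ltb _.
  by rewrite ler_nat; lia.
by rewrite ltNge bound_sqr.
Qed.

(** * Projections with weighted sums *)

(** Let [x k = p * r k * p]; then [p - 2 x k] is a contraction, as the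
    compression of a reflection.  If the [c k *: x k] add up to [0], a negative
    multiple of [x k0] is a positive combination of the other [x k], so
    [p - z] and [p + z] are both convex combinations of such contractions and
    [p] for a suitable multiple [z] of [x k0].  Extremality of [p] gives
    [z = 0], and then [r k0 * p] vanishes by the C*-identity. *)
Lemma compressed_proj_sum_eq0 {R : realType} {A : cstarAlgType R} (K : finType)
    (c : K -> R) (p : A) (r : K -> A) :
  is_proj p -> (forall k, is_proj (r k)) -> (forall k, 0 <= c k) ->
  \sum_k (c k)%:C%C *: (p * r k * p) = 0 ->
  forall k, 0 < c k -> r k * p = 0.
Proof.
move=> pP rP c_ge0 sum0 k0 ck0_gt0; have [ps pp] := pP.
pose x k := p * r k * p.
have p1 : cnorm p <= 1 by exact: cnorm_proj_le1.
have y1 k : cnorm (p - x k *+ 2) <= 1.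
  have -> : p - x k *+ 2 = p * (1 - r k *+ 2) * p.
    by rewrite mulrBr mulr1 mulrBl pp mulrnAr mulrnAl.
  by rewrite cnormM_le1 // cnormM_le1 // cnorm_reflection_le1.
pose M := \sum_k c k; pose M' := \sum_(k | k != k0) c k.
have MD : M = c k0 + M' by rewrite /M (bigD1 k0).
have M'_ge0 : 0 <= M' by rewrite sumr_ge0.
have M_gt0 : 0 < M by rewrite MD ltr_pwDl.
pose z := (2 * c k0 / M)%:C%C *: x k0.
have Mz : M%:C%C *: z = (c k0)%:C%C *: (x k0 *+ 2).
  rewrite /z scalerA -rmorphM /= mulrCA divff ?gt_eqF // mulr1 mulrC.
  by rewrite rmorphM /= -scalerA rmorph_nat scaler_nat.
have cnormMz y : cnorm (M%:C%C *: y) <= M -> cnorm y <= 1.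
  by rewrite cnormZr (gtr0_norm M_gt0) -ler_pdivlMl // mulVf // gt_eqF.
have px k : p * x k = x k by rewrite /x !mulrA pp.
have xp k : x k * p = x k by rewrite /x -!mulrA pp.
have z0 : z = 0.
  apply: (proj_extreme p) => //.
  - by rewrite /z -scalerAr px.
  - by rewrite /z -scalerAl xp.
  - apply: cnormMz.
    have -> : M%:C%C *: (p + z) = (c k0)%:C%C *: p +
        \sum_(k | k != k0) (c k)%:C%C *: (p - x k *+ 2).
      under eq_bigr => k _ do rewrite scalerBr -scalerMnr.
      rewrite sumrB sumrMnl -scaler_suml -rmorph_sum addrA -scalerDl.
      rewrite -rmorphD -MD scalerDr Mz -scalerMnr; congr (_ + _).
      move: sum0; rewrite (bigD1 k0) //= => /eqP.
      by rewrite addr_eq0 => /eqP ->; rewrite mulNrn.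
    apply: le_trans (cnormD _ _) _; rewrite MD lerD //.
      by rewrite cnormZr ger0_norm // ler_piMr.
    apply: le_trans (cnorm_sum _ _ _ _) _; apply: ler_sum => k _.
    by rewrite cnormZr ger0_norm // ler_piMr.
  - apply: cnormMz.
    have -> : M%:C%C *: (p - z) = M'%:C%C *: p + (c k0)%:C%C *: (p - x k0 *+ 2).
      by rewrite !scalerBr Mz addrA -scalerDl -rmorphD MD (addrC M').
    apply: le_trans (cnormD _ _) _; rewrite MD addrC lerD //.
      by rewrite cnormZr ger0_norm // ler_piMr.
    by rewrite cnormZr ger0_norm // ler_piMr.
have x0 : x k0 = 0.
  have := Mz; rewrite z0 scaler0 => /esym/eqP.
  rewrite scaler_eq0 -scaler_nat scaler_eq0 pnatr_eq0 /=.
  by rewrite (inj_eq (@complexI R)) gt_eqF //= => /eqP.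
have [rs rr] := rP k0.
apply: cnorm_eq0; apply/eqP; rewrite -sqrf_eq0 -cnorm_star starM rs ps.
by rewrite mulrA -(mulrA p) rr -/(x k0) x0 cnorm0.
Qed.

(** Compressing the column relation [\sum_v n v * q i v = n i] by [q i v]
    gives a vanishing sum whose weights are [n v - n i] at [v] and [n w] at
    [w != v].  If [n v >= n i] they are nonnegative, so [q i w * q i v = 0] for
    [w != v], and [q i v = 0] if [n v > n i].  For [n v < n i], divide the
    column relation by [n i] and sum over [i]: this total is the number of
    points of [X], as is the total of all rows.  Hence the elements
    [(1 - n v / n i) * q i v] add up to [0]; those with [n v > n i] being zero,
    no negative weight is left and [q i v = 0] if [n v < n i] too. *)
Lemma weighted_magic_orthogonal {R : realType} {A : cstarAlgType R}
    (X : finType) (n : X -> nat) (q : X -> X -> A) :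
  (forall v, (0 < n v)%N) ->
  (forall i v, is_proj (q i v)) ->
  (forall v, \sum_i q i v = 1) ->
  (forall i, \sum_v q i v *+ n v = (n i)%:R) ->
  forall i v w, v != w -> q i v * q i w = 0.
Proof.
move=> n_gt0 qP row_sum col_sum.
have nR_gt0 v : 0 < (n v)%:R :> R by rewrite ltr0n.
(* The weights after the term [n i * q i v] has been moved to the left. *)
pose c i v w : R := if w == v then (n v)%:R - (n i)%:R else (n w)%:R.
have col_compress i v :
    \sum_w (c i v w)%:C%C *: (q i v * q i w * q i v) = 0.
  have [_ qq] := qP i v.
  have : \sum_w (q i v * q i w * q i v) *+ n w = q i v *+ n i.
    have <- : q i v * (n i)%:R * q i v = q i v *+ n i.
      by rewrite mulr_natr mulrnAl qq.
    rewrite -col_sum mulr_sumr mulr_suml.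
    by apply: eq_bigr => w _; rewrite mulrnAr mulrnAl.
  rewrite (bigD1 v) //= !qq => e; rewrite (bigD1 v) //= !qq /c eqxx.
  rewrite rmorphB scalerBl !rmorph_nat !scaler_nat -e opprD addrA subrr add0r.
  apply/eqP; rewrite addrC subr_eq0; apply/eqP; apply: eq_bigr => w /negbTE ->.
  by rewrite rmorph_nat scaler_nat.
have col_orth i v w : (n i <= n v)%N -> 0 < c i v w -> q i w * q i v = 0.
  move=> le_iv; apply: (compressed_proj_sum_eq0 X (c i v)) => // k.
  by rewrite /c; case: eqP => _; rewrite ?subr_ge0 ?ler_nat.
have q_gt i v : (n i < n v)%N -> q i v = 0.
  move=> lt_iv; have [_ <-] := qP i v; apply: col_orth; first exact: ltnW.
  by rewrite /c eqxx subr_gt0 ltr_nat.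
have q_lt i v : (n v < n i)%N -> q i v = 0.
  move=> lt_vi.
  pose d (k : X * X) : R :=
    if (n k.2 <= n k.1)%N then 1 - (n k.2)%:R / (n k.1)%:R else 0.
  have := compressed_proj_sum_eq0 (X * X)%type d 1 (fun k => q k.1 k.2).
  move/(_ is_proj1 (fun k => qP k.1 k.2)) => /(_ _ _ (i, v)) /=.
  rewrite mulr1; apply.
  - move=> k; rewrite /d; case: ifP => // le21.
    by rewrite subr_ge0 ler_pdivrMr // mul1r ler_nat.
  - rewrite (eq_bigr (fun k : X * X => q k.1 k.2 -
        ((n k.1)%:R^-1)%:C%C *: (q k.1 k.2 *+ n k.2))); last first.
      move=> [j w] _ /=; rewrite mulr1 mul1r /d /=; case: leqP => [_|lt_jw].
        rewrite rmorphB rmorph1 scalerBl scale1r mulrC rmorphM -scalerA.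
        by rewrite rmorph_nat scaler_nat.
      by rewrite q_gt // mul0rn !scaler0 subrr.
    rewrite sumrB -(pair_big predT predT q) exchange_big /=.
    under eq_bigr do rewrite row_sum.
    rewrite -(pair_big predT predT
      (fun j w => ((n j)%:R^-1)%:C%C *: (q j w *+ n w))) /=.
    rewrite [X in _ - X](eq_bigr (fun=> 1)) ?subrr // => j _.
    rewrite -scaler_sumr col_sum -scaler_nat scalerA.
    rewrite -(rmorph_nat (@real_complex R)) -rmorphM.
    by rewrite mulVf ?gt_eqF // scale1r.
  - by rewrite /d /= ltnW // subr_gt0 ltr_pdivrMr // mul1r ltr_nat.
move=> i v w neq_vw; case: (ltnP (n w) (n i)) => [lt_wi|le_iw].
  by rewrite (q_lt i w) ?mulr0.
by apply: col_orth; rewrite // /c (negbTE neq_vw).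
Qed.

(** * Sums of coefficients over the fibers of a map *)

Lemma sum_mulrnb {V : nmodType} {I : finType} (F : I -> V) (i : I) :
  \sum_j F j *+ (j == i) = F i.
Proof.
by rewrite (bigD1 i) //= eqxx big1 ?addr0 // => j /negbTE ->.
Qed.

Section FiberSums.
Context {R : realType} {A : cstarAlgType R} {E X : finType}.
Context (s : E -> X) (u : E -> E -> A) (q : X -> X -> A).
Hypothesis s_surj : forall v, exists sigma, s sigma = v.
Hypothesis row_orth : forall sigma rho,
  \sum_tau u sigma tau * star (u rho tau) = (sigma == rho)%:R.
Hypothesis adj_orth : forall tau rho,
  \sum_sigma star (u sigma tau) * u sigma rho = (tau == rho)%:R.
Hypothesis col_orth : forall tau rho,
  \sum_sigma u sigma tau * star (u sigma rho) = (tau == rho)%:R.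
Hypothesis fiber_diag : forall i sigma rho,
  \sum_(tau | s tau == i) u sigma tau * star (u rho tau)
    = q i (s sigma) *+ (rho == sigma).

Lemma fiber_diagE i sigma :
  q i (s sigma) = \sum_(tau | s tau == i) u sigma tau * star (u sigma tau).
Proof. by rewrite fiber_diag eqxx. Qed.

(** Since the fiber sums are diagonal, [q i (s sigma) * u sigma tau] is the sum
    of [u sigma kappa * star (u rho kappa) * u rho tau] over [kappa] in the
    fiber and over all [rho]; the sum over [rho] leaves [kappa = tau] only. *)
Lemma fiber_mul_coef i sigma tau :
  q i (s sigma) * u sigma tau = u sigma tau *+ (s tau == i).
Proof.
transitivity (\sum_rho (q i (s sigma) *+ (rho == sigma)) * u rho tau).
  under eq_bigr do rewrite mulrnAl.
  by rewrite (sum_mulrnb (fun rho => _ * u rho tau)).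
under eq_bigr do rewrite -fiber_diag mulr_suml.
rewrite exchange_big /=.
under eq_bigr => kappa _.
  under eq_bigr do rewrite -mulrA.
  rewrite -mulr_sumr adj_orth mulr_natr; over.
rewrite big_mkcond.
rewrite -[RHS](sum_mulrnb (fun kappa => u sigma kappa *+ (s kappa == i))).
by apply: eq_bigr => kappa _; case: eqP => _; rewrite ?mulr0n ?mul0rn.
Qed.

Lemma fiber_mul i j v : q i v * q j v = q j v *+ (j == i).
Proof.
have [sigma <-] := s_surj v.
rewrite (fiber_diagE j) mulr_sumr -sumrMnl; apply: eq_bigr => tau /eqP <-.
by rewrite mulrA fiber_mul_coef mulrnAl.
Qed.

Lemma fiber_star i v : star (q i v) = q i v.
Proof.
have [sigma <-] := s_surj v; rewrite fiber_diagE star_sum.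
by apply: eq_bigr => tau _; rewrite starM starK.
Qed.

Lemma fiber_proj i v : is_proj (q i v).
Proof. by split; rewrite ?fiber_star // fiber_mul eqxx. Qed.

Lemma fiber_row_sum v : \sum_i q i v = 1.
Proof.
have [sigma <-] := s_surj v; under eq_bigr do rewrite fiber_diagE.
transitivity (\sum_tau u sigma tau * star (u sigma tau)).
  by rewrite [RHS](partition_big s predT).
by rewrite row_orth eqxx.
Qed.

(** The weight of [v] counts the rows [sigma] on which the value [q i v] is
    attained; summing over all rows brings in the columns of [u], which are
    orthonormal because the contragredient is unitary. *)
Lemma fiber_col_sum i :
  \sum_v q i v *+ #|[pred sigma | s sigma == v]|
    = #|[pred sigma | s sigma == i]|%:R.
Proof.
transitivity (\sum_sigma q i (s sigma)).
  rewrite (partition_big s predT) //=; apply: eq_bigr => v _.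
  by rewrite -sumr_const; apply: eq_bigr => sigma /eqP ->.
under eq_bigr do rewrite fiber_diagE.
rewrite exchange_big /= -sumr_const; apply: eq_bigr => tau _.
by rewrite col_orth eqxx.
Qed.

Lemma fiber_col_orth i v w : v != w -> q i v * q i w = 0.
Proof.
apply: (weighted_magic_orthogonal X (fun v => #|[pred sigma | s sigma == v]|)).
- move=> x; have [sigma <-] := s_surj x.
  by apply/card_gt0P; exists sigma; rewrite inE.
- exact: fiber_proj.
- exact: fiber_row_sum.
- exact: fiber_col_sum.
Qed.

End FiberSums.

(** * The co-action given by the fiber sums *)

Lemma cst_suml {R : realType} {A B T : cstarAlgType R} {t : A -> B -> T}
    (tP : cstar_tensor t) (I : Type) (r : seq I) (P : pred I) (F : I -> A) b :
  t (\sum_(i <- r | P i) F i) b = \sum_(i <- r | P i) t (F i) b.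
Proof.
apply: (big_morph (fun a => t a b) (fun a a' => cst_addl tP a a' b)).
by rewrite -(scale0r (0 : A)) (cst_scalel tP) scale0r.
Qed.

Lemma cst_sumr {R : realType} {A B T : cstarAlgType R} {t : A -> B -> T}
    (tP : cstar_tensor t) (I : Type) (r : seq I) (P : pred I) (F : I -> B) a :
  t a (\sum_(i <- r | P i) F i) = \sum_(i <- r | P i) t a (F i).
Proof.
apply: (big_morph (t a) (cst_addr tP a)).
by rewrite -(scale0r (0 : B)) (cst_scaler tP) scale0r.
Qed.

Lemma ush_sum {R : realType} {A B : cstarAlgType R} {f : A -> B}
    (fP : unital_star_hom f) (I : Type) (r : seq I) (P : pred I) (F : I -> A) :
  f (\sum_(i <- r | P i) F i) = \sum_(i <- r | P i) f (F i).
Proof.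
apply: (big_morph f (ush_add fP)).
by rewrite -(scale0r (0 : A)) (ush_scale fP) scale0r.
Qed.

Definition fiber_coaction {R : realType} {A : cstarAlgType R} {X : finType}
    (q : X -> X -> A) (f : {ffun X -> R[i]}) : {ffun X -> A} :=
  [ffun v => \sum_i f i *: q i v].

Lemma fiber_coaction_is_linear {R : realType} {A : cstarAlgType R}
    {X : finType} (q : X -> X -> A) : linear (fiber_coaction q).
Proof.
move=> a f g; apply/ffunP => v; rewrite !ffunE scaler_sumr -big_split /=.
by apply: eq_bigr => i _; rewrite !ffunE scalerDl scalerA.
Qed.

HB.instance Definition _ (R : realType) (A : cstarAlgType R) (X : finType)
    (q : X -> X -> A) :=
  GRing.isLinear.Build R[i] {ffun X -> R[i]} {ffun X -> A} _
    (fiber_coaction q) (fiber_coaction_is_linear q).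

Lemma fiber_coaction_chi {R : realType} {A : cstarAlgType R} {X : finType}
    (q : X -> X -> A) i v : fiber_coaction q (chi R i) v = q i v.
Proof.
rewrite ffunE -[RHS](sum_mulrnb (q^~ v)); apply: eq_bigr => j _.
by rewrite ffunE scaler_nat.
Qed.

(** Coassociativity: [Delta (q i (s sigma))] is a sum of
    [(u sigma kappa * star (u sigma lambda)) (x) (fiber sum at kappa, lambda)],
    in which diagonality leaves [kappa = lambda].  Density: the orthogonality
    of the [q i v] for fixed [i] exhibits each [F] in the span itself. *)
Lemma fiber_coactionP {R : realType} {A : compactQuantumGroup R}
    {E X : finType} (s : E -> X) (u : E -> E -> A) (q : X -> X -> A) :
  (forall v, exists sigma, s sigma = v) ->
  (forall sigma tau, cqg_Delta (u sigma tau) =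
     \sum_kappa cqg_t (u sigma kappa) (u kappa tau)) ->
  (forall sigma rho,
     \sum_tau u sigma tau * star (u rho tau) = (sigma == rho)%:R) ->
  (forall tau rho,
     \sum_sigma star (u sigma tau) * u sigma rho = (tau == rho)%:R) ->
  (forall tau rho,
     \sum_sigma u sigma tau * star (u sigma rho) = (tau == rho)%:R) ->
  (forall i sigma rho,
     \sum_(tau | s tau == i) u sigma tau * star (u rho tau)
       = q i (s sigma) *+ (rho == sigma)) ->
  coaction (fiber_coaction q).
Proof.
move=> s_surj corep row adj col diag.
have qM := fiber_mul _ _ _ s_surj adj diag.
have qs := fiber_star _ _ _ s_surj diag.
have q1 := fiber_row_sum _ _ _ s_surj row diag.
have q_orth := fiber_col_orth _ _ _ s_surj row adj col diag.
have tP := proj1 (cqg_tP A); have DP := cqg_Delta_hom A.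
split.
- move=> f g; apply/ffunP => v; rewrite !ffunE mulr_suml.
  apply: eq_bigr => i _; rewrite ffunE mulr_sumr.
  rewrite -(sum_mulrnb (fun j => (f i * g j) *: q j v) i).
  apply: eq_bigr => j _.
  by rewrite -scalerAr -scalerAl scalerA qM mulrC scalerMnr.
- apply/ffunP => v; rewrite !ffunE -[RHS](q1 v).
  by apply: eq_bigr => i _; rewrite ffunE scale1r.
- move=> f; apply/ffunP => v; rewrite !ffunE star_sum.
  by apply: eq_bigr => i _; rewrite ffunE starZ qs.
- have Delta_q i y : \sum_x cqg_t (q x y) (q i x) = cqg_Delta (q i y).
    have [sigma <-] := s_surj y.
    rewrite (fiber_diagE _ _ _ diag i) (ush_sum DP).
    under [RHS]eq_bigr => tau _.
      rewrite (ush_mul DP) (ush_star DP) !corep star_sum mulr_suml.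
      under eq_bigr => kappa _.
        rewrite mulr_sumr.
        under eq_bigr do rewrite (cst_star tP) (cst_mul tP).
        over.
      over.
    rewrite exchange_big /=.
    under [RHS]eq_bigr => kappa _.
      rewrite exchange_big /=.
      under eq_bigr => lambda _.
        rewrite -(cst_sumr tP) diag.
        over.
      over.
    rewrite /=.
    transitivity (\sum_kappa
      cqg_t (u sigma kappa * star (u sigma kappa)) (q i (s kappa))).
      rewrite [RHS](partition_big s predT) //=; apply: eq_bigr => x _.
      rewrite (fiber_diagE _ _ _ diag x) (cst_suml tP).
      by apply: eq_bigr => kappa /eqP ->.
    apply: eq_bigr => kappa _.
    rewrite -(sum_mulrnb (fun lambda =>
      cqg_t (u sigma kappa * star (u sigma lambda)) (q i (s kappa))) kappa).
    apply: eq_bigr => lambda _; case: eqP => // _.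
    by rewrite !mulr0n -(scale0r (0 : A)) (cst_scaler tP) scale0r.
  move=> f y.
  under eq_bigr => x _.
    rewrite fiber_coaction_chi ffunE (cst_sumr tP).
    under eq_bigr do rewrite (cst_scaler tP).
    over.
  rewrite exchange_big /= ffunE (ush_sum DP); apply: eq_bigr => i _.
  by rewrite -scaler_sumr Delta_q (ush_scale DP).
- move=> F e e_gt0.
  pose a i := \sum_w q i w * F w.
  exists (\sum_(k < #|X|) 1 *:
     [ffun x => fiber_coaction q (chi R (enum_val k)) x * a (enum_val k)]).
    by exists #|X|, (fun=> 1), (fun k => [ffun x =>
       fiber_coaction q (chi R (enum_val k)) x * a (enum_val k)]); split=> // k;
       exists (chi R (enum_val k)), (a (enum_val k)).
  move=> v; rewrite sum_ffunE.
  under eq_bigr do rewrite scale1r ffunE fiber_coaction_chi.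
  rewrite -(big_enum_val (fun i => q i v * a i)) /=.
  suff -> : \sum_(i in X) q i v * a i = F v by rewrite subrr cnorm0.
  transitivity (\sum_i q i v * F v); last by rewrite -mulr_suml q1 mul1r.
  apply: eq_bigr => i _; rewrite /a (bigD1 v) //= mulrDr mulrA qM eqxx.
  rewrite mulr_sumr big1 ?addr0 // => w neq_wv.
  by rewrite mulrA q_orth ?mul0r // eq_sym.
Qed.

(** * The adjoint co-action on functions of the source *)

Lemma src_s_surj (G : multigraph) (v : Vs G) : exists sigma, src_s sigma = v.
Proof.
case: v => v vP; have /imsetP[sigma _ v_def] := vP.
by exists sigma; apply: val_inj.
Qed.

Lemma sum_enum_rank {V : nmodType} (E : finType) (F : 'I_#|E| -> V) :
  \sum_i F i = \sum_e F (enum_rank e).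
Proof. exact: (reindex (@enum_rank E) (onW_bij _ (@enum_rank_bij E))). Qed.

Lemma unitary_mx_corep {R : realType} {A : compactQuantumGroup R} {E : finType}
    (beta : {linear {ffun E -> R[i]} -> {ffun E -> A}}) :
  unitary_mx (corep_mx beta) ->
  (forall tau rho,
     \sum_sigma star (coef beta sigma tau) * coef beta sigma rho
       = (tau == rho)%:R) /\
  (forall sigma rho,
     \sum_tau coef beta sigma tau * star (coef beta rho tau)
       = (sigma == rho)%:R).
Proof.
move=> [UsU UUs]; split=> x y.
- have := congr1 (fun M : 'M_ _ => M (enum_rank x) (enum_rank y)) UsU.
  rewrite !mxE (inj_eq enum_rank_inj) sum_enum_rank => <-.
  by apply: eq_bigr => z _; rewrite !mxE !enum_rankK.
- have := congr1 (fun M : 'M_ _ => M (enum_rank x) (enum_rank y)) UUs.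
  rewrite !mxE (inj_eq enum_rank_inj) sum_enum_rank => <-.
  by apply: eq_bigr => z _; rewrite !mxE !enum_rankK.
Qed.

Lemma unitary_mx_contragredient {R : realType} {A : compactQuantumGroup R}
    {E : finType} (beta : {linear {ffun E -> R[i]} -> {ffun E -> A}}) :
  unitary_mx (contragredient_mx beta) ->
  forall tau rho,
    \sum_sigma coef beta sigma tau * star (coef beta sigma rho)
      = (tau == rho)%:R.
Proof.
move=> [UsU _] x y.
have := congr1 (fun M : 'M_ _ => M (enum_rank x) (enum_rank y)) UsU.
rewrite !mxE (inj_eq enum_rank_inj) sum_enum_rank => <-.
by apply: eq_bigr => z _; rewrite !mxE !enum_rankK starK.
Qed.

Lemma SmapE {R : realType} {G : multigraph} (f : {ffun Vs G -> R[i]})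
    (sigma rho : edge G) :
  Smap f (enum_rank sigma) (enum_rank rho) = f (src_s sigma) *+ (rho == sigma).
Proof.
transitivity (\sum_tau f (src_s tau) *+ (rho == tau) *+ (tau == sigma)).
  rewrite /Smap summxE [RHS](partition_big (@src_s G) predT) //=.
  apply: eq_bigr => v _; rewrite mxE summxE mulr_sumr.
  apply: eq_bigr => tau /eqP <-.
  rewrite mxE !(inj_eq enum_rank_inj) [sigma == tau]eq_sym.
  by rewrite -mulrnA mulnb mulr_natr andbC.
exact: (sum_mulrnb (fun tau => f (src_s tau) *+ (rho == tau))).
Qed.

Lemma Ad_SmapE {R : realType} {G : multigraph} {A : compactQuantumGroup R}
    (beta : {linear {ffun edge G -> R[i]} -> {ffun edge G -> A}})
    (f : {ffun Vs G -> R[i]}) (sigma rho : edge G) :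
  Ad beta (Smap f) (enum_rank sigma) (enum_rank rho) =
  \sum_tau f (src_s tau) *: (coef beta sigma tau * star (coef beta rho tau)).
Proof.
rewrite /Ad mxE sum_enum_rank; apply: eq_bigr => tau _.
rewrite mxE sum_enum_rank !mxE !enum_rankK scalerAl; congr (_ * _).
rewrite -(sum_mulrnb (fun kappa => f (src_s kappa) *: coef beta sigma kappa)).
apply: eq_bigr => kappa _; rewrite !mxE !enum_rankK SmapE.
by rewrite -scalerAr mulr1 scalerMnl eq_sym.
Qed.

(** For the converse, expand [M] along the matrices [S (chi v)]. *)
Lemma sub_tens_SmapP {R : realType} {G : multigraph} {A : cstarAlgType R}
    (M : 'M[A]_#|edge G|) :
  sub_tens A (range (@Smap R G)) M <->
  exists a : Vs G -> A, forall sigma rho,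
    M (enum_rank sigma) (enum_rank rho) = a (src_s sigma) *+ (rho == sigma).
Proof.
split=> [[m [T [b [TP ->]]]]|[a Ma]].
  have [f Tf] := choice (fun k =>
    let: ex_intro2 g _ e := TP k in ex_intro _ g e).
  exists (fun v => \sum_k f k v *: b k) => sigma rho.
  rewrite summxE -sumrMnl; apply: eq_bigr => k _.
  by rewrite mxE -Tf SmapE scalerMnl.
exists #|Vs G|, (fun k => Smap (chi R (enum_val k))), (fun k => a (enum_val k)).
split=> [k|]; first by exists (chi R (enum_val k)).
apply/matrixP=> i j; rewrite -(enum_valK i) -(enum_valK j) Ma summxE.
rewrite -[in LHS](sum_mulrnb a) -sumrMnl.
transitivity (\sum_(k in Vs G) tens_mx (Smap (chi R k)) (a k)
  (enum_rank (enum_val i)) (enum_rank (enum_val j))); last first.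
  by rewrite (big_enum_val (fun k => tens_mx (Smap (chi R k)) (a k) _ _)).
apply: eq_bigr => v _; rewrite mxE SmapE ffunE -scalerMnl.
by rewrite scaler_nat eq_sym.
Qed.

Theorem theorem3p4 (R : realType) (G : multigraph)
    (hG : no_isolated_vertex G) (A : compactQuantumGroup R)
    (beta : {linear {ffun edge G -> R[i]} -> {ffun edge G -> A}})
    (hbeta : corepresentation beta) (hbi : bi_unitary beta) :
  (forall f : {ffun Vs G -> R[i]},
     sub_tens A (range (@Smap R G)) (Ad beta (Smap f)))
  <->
  (exists2 alpha : {linear {ffun Vs G -> R[i]} -> {ffun Vs G -> A}},
     coaction alpha
     & forall (i : Vs G) (tau : edge G),
         act (alpha (chi R i)) (beta (chi R tau))
           = beta (act (chi R i) (chi R tau))).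
Proof.
have [U_unitary Ubar_unitary] := hbi.
have [adj_orth row_orth] := unitary_mx_corep _ U_unitary.
have col_orth := unitary_mx_contragredient _ Ubar_unitary.
(* The module condition, read on the coefficients of [beta]. *)
have actE (alpha : {ffun Vs G -> R[i]} -> {ffun Vs G -> A}) i tau :
    act (alpha (chi R i)) (beta (chi R tau)) = beta (act (chi R i) (chi R tau))
    <-> forall sigma, alpha (chi R i) (src_s sigma) * coef beta sigma tau
          = coef beta sigma tau *+ (src_s tau == i).
  rewrite act_chi scaler_nat raddfMn eq_sym; split=> [/ffunP e sigma|e].
    by have := e sigma; rewrite ffunE ffunMnE.
  by apply/ffunP => sigma; rewrite ffunE ffunMnE; exact: e.
split=> [AdS|[alpha _ act_alpha] f].
- have [q q_diag] := choice (fun i => proj1 (sub_tens_SmapP _) (AdS (chi R i))).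
  have diag i sigma rho :
      \sum_(tau | src_s tau == i) coef beta sigma tau * star (coef beta rho tau)
        = q i (src_s sigma) *+ (rho == sigma).
    rewrite -q_diag Ad_SmapE big_mkcond; apply: eq_bigr => tau _.
    by rewrite ffunE; case: eqP => _; rewrite ?scale1r ?scale0r.
  exists (fiber_coaction q).
    exact: (fiber_coactionP _ _ _ (@src_s_surj G) hbeta
      row_orth adj_orth col_orth diag).
  move=> i tau; apply/actE => sigma; rewrite fiber_coaction_chi.
  exact: (fiber_mul_coef _ _ _ adj_orth diag).
- apply/sub_tens_SmapP; exists (alpha f) => sigma rho; rewrite Ad_SmapE.
  have alphaM tau : alpha f (src_s sigma) * coef beta sigma tau
      = f (src_s tau) *: coef beta sigma tau.
    have -> : f = \sum_i f i *: chi R i.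
      apply/ffunP => v; rewrite sum_ffunE -[LHS](sum_mulrnb f).
      apply: eq_bigr => i _; rewrite !ffunE eq_sym.
      by rewrite /GRing.scale /= mulr_natr.
    rewrite linear_sum sum_ffunE mulr_suml sum_ffunE scaler_suml.
    apply: eq_bigr => i _; rewrite linearZ !ffunE -scalerAl.
    rewrite (proj1 (actE alpha i tau) (act_alpha i tau)).
    by rewrite -scaler_nat scalerA.
  under eq_bigr do rewrite scalerAl -alphaM -mulrA.
  by rewrite -mulr_sumr row_orth mulr_natr eq_sym.
Qed.
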